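(* If $D$ is a digraph of order $n$, then $$dc(D)+dc(D^{c})\leq \left\lceil \frac{4n}{3}\right\rceil \quad\text{and}\quad dc(D)\,dc(D^{c})\leq \left(\frac{2n+1}{3}\right)^{2},$$ $$dac(D)+dc(D^{c})\leq \left\lceil \frac{3n}{2}\right\rceil \quad\text{and}\quad dac(D)\,dc(D^{c})\leq\left(\frac{3n+1}{4}\right)^{2}.$$
   Context: Digraphs are finite, without loops and without parallel arcs (both $(x,y)$ and $(y,x)$ may be arcs); the order is the number of vertices. A vertex coloring of a digraph $D$ with $k$ colors is a surjective function $V(D)\to[k]=\{1,\dots,k\}$; the preimages of the colors are the chromatic classes. A coloring is acyclic if no chromatic class induces a subdigraph containing a directed cycle (a 2-cycle $x\to y\to x$ counts as a directed cycle). A coloring is complete if for every ordered pair $(i,j)$ of different colors there is at least one arc $(x,y)$ such that $x$ has color $i$ and $y$ has color $j$. The dichromatic number $dc(D)$ is the smallest $k$ such that $D$ has an acyclic coloring with $k$ colors. The diachromatic number $dac(D)$ is the largest $k$ such that $D$ has a complete and acyclic coloring with $k$ colors. The complement $D^{c}$ of $D$ is the digraph with vertex set $V(D)$ in which, for distinct vertices $x,y$, $(x,y)$ is an arc if and only if $(x,y)$ is not an arc of $D$. *)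

(* Defs.v *)
From mathcomp Require Import all_boot.

Set Implicit Arguments.
Unset Strict Implicit.
Unset Printing Implicit Defensive.

Record digraph := Digraph {
  vertex :> finType;
  arc : rel vertex;
  arc_irr : irreflexive arc
}.

Section Constructions.
Variable D : digraph.

Definition compl_arc : rel D := [rel x y | (x != y) && ~~ arc x y].

Lemma compl_arc_irr : irreflexive compl_arc.
Proof. by move=> x; rewrite /compl_arc /= eqxx. Qed.

Definition complement : digraph := Digraph compl_arc_irr.

Definition induced_arc (A : {set D}) : rel {x : D | x \in A} :=
  [rel u v | arc (val u) (val v)].

Lemma induced_arc_irr (A : {set D}) : irreflexive (@induced_arc A).
Proof. by move=> u; apply: arc_irr. Qed.

Definition induced (A : {set D}) : digraph := Digraph (@induced_arc_irr A).

(* The vertices of a directed cycle are pairwise distinct, so its length is at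
   most the order; tuples of bounded length make the predicate decidable (see
   [has_dicycleP]).  Length 1 is excluded by the absence of loops, length 2 is
   allowed. *)
Definition has_dicycle : bool :=
  [exists m : 'I_#|D|.+1, exists s : m.-tuple D,
    (0 < m) && ucycleb (@arc D) s].

Lemma has_dicycleP :
  reflect (exists2 s : seq D, s != [::] & ucycle (@arc D) s) has_dicycle.
Proof.
apply: (iffP existsP) => [[m /existsP[s /andP[m0 cs]]]|[s s0 cs]].
  by exists s => //; rewrite -size_eq0 size_tuple -lt0n.
have sz : size s < #|D|.+1.
  by rewrite ltnS; case/andP: cs => _ /card_uniqP <-; apply: max_card.
exists (Ordinal sz); apply/existsP; exists (in_tuple s).
by rewrite /= lt0n size_eq0 s0; apply: cs.
Qed.

End Constructions.

Section Colorings.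
Variable D : digraph.

Section Fixed.
Variables (k : nat) (c : {ffun D -> 'I_k}).

Definition surjective : bool := [forall i, exists x, c x == i].

Definition chromatic_class (i : 'I_k) : {set D} := [set x | c x == i].

Definition acyclic : bool :=
  [forall i, ~~ has_dicycle (induced (chromatic_class i))].

Definition complete : bool :=
  [forall i, forall j, (i != j) ==>
    [exists x, exists y, [&& arc x y, c x == i & c y == j]]].

Lemma acyclicP :
  reflect (forall (i : 'I_k) (s : seq D), s != [::] -> ucycle (@arc D) s ->
             ~~ all (fun x => c x == i) s)
          acyclic.
Proof.
apply: (iffP forallP) => [ac i s s0 /andP[cs us]|ac i].
  apply/negP => /allP si; have /negP := ac i; apply; apply/has_dicycleP.
  have sA : all (mem (chromatic_class i)) s.
    by apply/allP => x /si /=; rewrite inE.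
  have [t Et] : exists t : seq {x : D | x \in chromatic_class i},
      s = map val t.
    elim: s sA {s0 cs us si} => [|x s IH] /=; first by exists [::].
    by case/andP=> xA /IH[t ->]; exists (exist _ x xA :: t).
  exists t; first by move: s0; rewrite Et; case: (t).
  rewrite /ucycle; apply/andP; split; last first.
    by move: us; rewrite Et map_inj_uniq //; apply: val_inj.
  by move: cs; rewrite Et cycle_map.
apply/has_dicycleP => -[t t0 /andP[ct ut]].
have/negP: ~~ all (fun x => c x == i) (map val t).
  apply: ac; first by case: (t) t0.
  by rewrite /ucycle cycle_map map_inj_uniq ?ut ?andbT //; apply: val_inj.
apply; by apply/allP => _ /mapP[x _ ->]; have := valP x; rewrite inE.
Qed.

End Fixed.

Definition acyclic_colorable (k : nat) : bool :=
  [exists c : {ffun D -> 'I_k}, surjective c && acyclic c].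

Definition complete_acyclic_colorable (k : nat) : bool :=
  [exists c : {ffun D -> 'I_k}, [&& surjective c, acyclic c & complete c]].

Lemma acyclic_colorable_ex : exists k, acyclic_colorable k.
Proof.
exists #|D|; apply/existsP; exists [ffun x => enum_rank x]; apply/andP; split.
  by apply/forallP => i; apply/existsP; exists (enum_val i);
    rewrite ffunE enum_valK.
apply/acyclicP => i [//|x s] _ /andP[cs us]; apply/negP => /= /andP[/eqP xi si].
case: s us cs si => [|y s] /= us cs; first by rewrite arc_irr in cs.
case/andP=> /eqP yi _; move: us.
rewrite inE negb_or -(inj_eq enum_rank_inj).
by move: xi yi; rewrite !ffunE => -> ->; rewrite eqxx.
Qed.

Definition dc : nat := ex_minn acyclic_colorable_ex.

Lemma surjective_leq k (c : {ffun D -> 'I_k}) : surjective c -> k <= #|D|.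
Proof.
move=> /forallP sc; rewrite -[k]card_ord.
have {}sc i : exists x, c x == i by apply/existsP.
apply: (leq_card (fun i => xchoose (sc i))) => i j Eij.
by rewrite -(eqP (xchooseP (sc i))) Eij (eqP (xchooseP (sc j))).
Qed.

Lemma complete_acyclic_colorable_leq k :
  complete_acyclic_colorable k -> k <= #|D|.
Proof. by case/existsP=> c /and3P[/surjective_leq]. Qed.

(* An acyclic coloring with the least number of colors is complete: without
   arcs from class [i] to class [j], merging the two classes creates no
   directed cycle. *)
Lemma complete_acyclic_colorable_dc : complete_acyclic_colorable dc.
Proof.
rewrite /dc; case: ex_minnP => k /existsP[c /andP[sc ac]] mink.
apply/existsP; exists c; rewrite sc ac /=.
apply/forallP => i; apply/forallP => j; apply/implyP => ij.
apply: contraT => noarc; exfalso.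
have {}noarc x y : c x = i -> c y = j -> ~~ arc x y.
  move=> xi yj; apply/negP => xy; case/negP: noarc.
  by apply/existsP; exists x; apply/existsP; exists y; rewrite xy xi yj !eqxx.
case: k => [|k] in c sc ac mink i j ij noarc *; first by case: i {ij noarc}.
have [j' Ej _] := unlift_some ij.
suff /mink : acyclic_colorable k by rewrite ltnn.
apply/existsP; exists [ffun x => odflt j' (unlift i (c x))].
apply/andP; split.
  apply/forallP => m; have /existsP[x /eqP xm] := forallP sc (lift i m).
  by apply/existsP; exists x; rewrite ffunE xm liftK.
apply/acyclicP => m s s0 cs; apply/negP => /allP sm.
have {}sm x : x \in s -> (c x = i /\ m = j') \/ c x = lift i m.
  move=> /sm; rewrite ffunE; case: unliftP => [l El|Ei] /eqP /= <-.
    by right.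
  by left.
have [Em|nmj] := eqVneq m j'; last first.
  have /negP := acyclicP _ ac (lift i m) s s0 cs; apply; apply/allP => x xs.
  by case: (sm x xs) => [[_ Em]|->//]; rewrite Em eqxx in nmj.
have {}sm x : x \in s -> c x = i \/ c x = j.
  by move=> /sm[[]|]; [left | rewrite Em -Ej; right].
have [/hasP[x xs /eqP xi]|/hasPn noi] := boolP (has (fun x => c x == i) s);
    last first.
  have /negP := acyclicP _ ac j s s0 cs; apply; apply/allP => x xs.
  by case: (sm x xs) => [xi|->//]; have := noi x xs; rewrite xi eqxx.
have /negP := acyclicP _ ac i s s0 cs; apply.
have [n t Et] := rot_to xs.
case/andP: cs => cs _; move: cs; rewrite -(rot_cycle n) Et /= => pt.
rewrite -(eq_all_r (mem_rot n s)) Et /= xi eqxx /=.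
have ts y : y \in t -> y \in s.
  by move=> yt; rewrite -(mem_rot n s) Et inE yt orbT.
move: pt; rewrite rcons_path => /andP[pt _].
elim: t x xi pt ts {Et xs} => //= y t IH x xi /andP[xy pt] ts.
have yi : c y = i.
  case: (sm y (ts y (mem_head _ _))) => // yj.
  by have := noarc x y xi yj; rewrite xy.
rewrite yi eqxx; apply: (IH y) => // z zt; apply: ts.
by rewrite inE zt orbT.
Qed.

Definition dac : nat :=
  ex_maxn (ex_intro _ dc complete_acyclic_colorable_dc)
          complete_acyclic_colorable_leq.

End Colorings.

(* Main.v *)
From mathcomp Require Import all_boot all_order all_algebra.
From mathcomp Require Import zify lra.
Require Import Defs.

(** Both products follow from the two sums by the inequality between the
    arithmetic and the geometric mean, so only the sums carry content.

    For the first sum, the stronger Nordhaus-Gaddum bound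
    [dc D + dc (complement D) <= n + 1] holds.  Add the vertices one at a time,
    keeping acyclic colorings of the current set [B] with [k] colors in [D] and
    [l] colors in the complement such that [k + l <= #|B| + 1].  A new vertex
    [v] can join any class that receives no arc from [v], because a cycle through [v]
    must leave [v]; otherwise it gets a fresh color.  If fresh colors are needed
    on both sides, then [v] sends arcs to all [k] classes in [D] and to all [l]
    classes in the complement.  The out-degrees of [v] into [B] in the two
    digraphs add up to [#|B|], hence [k + l <= #|B|], and there is room for two
    fresh colors.

    For the second sum, take a complete acyclic coloring of [D] with [dac D]
    colors, [s] of whose classes are singletons.  The other classes have at
    least two vertices, so [2 * dac D <= n + s].  By completeness the [s]
    vertices in singleton classes are pairwise joined in both directions in
    [D], so they are independent in the complement and can share a color there:
    [dc (complement D) <= n - s + 1] if [s > 0].  Adding these bounds gives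
    [2 * (dac D + dc (complement D)) <= 3 * n + 1]; when [s = 0], the trivial
    bound [dc (complement D) <= n] gives the same. *)

Set Implicit Arguments.
Unset Strict Implicit.
Unset Printing Implicit Defensive.

(** * Colorings by an arbitrary finite type *)

Section UpperBounds.
Variable D : digraph.

(** Renumbering the colors that occur makes the coloring surjective, as the
    definition of the dichromatic number demands. *)
Lemma dc_leq_imset (T : finType) (f : D -> T) :
    (forall (t : T) (s : seq D), s != [::] -> cycle (@arc D) s ->
       ~~ all (fun x => f x == t) s) ->
  dc D <= #|f @: [set: D]|.
Proof.
move=> fP; rewrite /dc; case: ex_minnP => k _; apply; apply/existsP.
pose c := [ffun x => enum_rank_in (imset_f f (in_setT x)) (f x)].
have cK x : enum_val (c x) = f x.
  by rewrite ffunE enum_rankK_in // imset_f ?inE.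
exists c; apply/andP; split.
  apply/forallP => i; have /imsetP[x _ xi] := enum_valP i.
  by apply/existsP; exists x; apply/eqP/enum_val_inj; rewrite cK.
apply/acyclicP => i s s0 /andP[cs _].
apply: contra (fP (enum_val i) s s0 cs) => /allP si.
by apply/allP => x /si /eqP <-; rewrite cK.
Qed.

Lemma dc_leq_order : dc D <= #|D|.
Proof. exact/complete_acyclic_colorable_leq/complete_acyclic_colorable_dc. Qed.

(** Color [S] with one color and each other vertex with its own: two
    consecutive vertices of a monochromatic cycle would then both lie in [S],
    since they are distinct. *)
Lemma dc_leq_independent (S : {set D}) :
    {in S &, forall x y, ~~ arc x y} ->
  dc D <= (#|~: S|).+1.
Proof.
move=> indep; pose f x := if x \in S then None else Some x.
apply: (@leq_trans #|f @: [set: D]|).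
  apply: dc_leq_imset => t [//|x s] _ cs; apply/negP => /allP st.
  have xs := mem_head x s; set s' := x :: s in cs st xs.
  have xy := next_cycle cs xs; have ys : next s' x \in s' by rewrite mem_next.
  have := st _ ys; rewrite -(eqP (st _ xs)) /f.
  case: ifP => yS; case: ifP => xS //.
    by rewrite (negPf (indep _ _ xS yS)) in xy.
  by move/eqP/Some_inj => yx; rewrite yx arc_irr in xy.
have sub : f @: [set: D] \subset None |: Some @: ~: S.
  apply/subsetP => _ /imsetP[x _ ->]; rewrite /f.
  by case: ifP => xS; rewrite !inE // imset_f // inE xS.
apply: leq_trans (subset_leq_card sub) _.
rewrite cardsU1 card_imset; last exact: Some_inj.
by rewrite -add1n leq_add2r leq_b1.
Qed.

End UpperBounds.

(** * Greedy extension of partial colorings *)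

Section PartialColorings.
Variable V : finType.
Implicit Types (e : rel V) (A B : {set V}) (f : V -> nat).

(** An acyclic coloring of the subdigraph induced on [A].  Colors are plain
    natural numbers, so that raising [k] leaves [f] unchanged.  Closed walks
    stand for cycles: the next vertex on a closed walk is all that is used. *)
Definition acyclic_on e A k f : Prop :=
  {in A, forall x, f x < k} /\
  forall i (s : seq V), s != [::] -> cycle e s -> {subset s <= A} ->
    ~~ all (fun x => f x == i) s.

(** A new vertex [v] without arcs to class [i] may join that class: a
    monochromatic cycle through [v] would leave [v] along such an arc. *)
Lemma acyclic_on_extend e B v k k' f i :
    irreflexive e -> acyclic_on e B k f -> k <= k' -> i < k' ->
    {in B, forall y, e v y -> f y != i} ->
  acyclic_on e (v |: B) k' (fun x => if x == v then i else f x).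
Proof.
move=> irr [fk fP] kk' ik' noarc; split=> [x|j s s0 cs sA].
  by rewrite !inE; case: eqP => //= _ /fk /leq_trans; apply.
apply/negP => /allP sj; have [vs|vs] := boolP (v \in s); last first.
  have nv x : x \in s -> x != v by move=> xs; apply: contraNneq vs => <-.
  have sB : {subset s <= B}.
    by move=> x xs; have := sA x xs; rewrite !inE (negPf (nv x xs)).
  have /negP := fP j s s0 cs sB; apply; apply/allP => x xs.
  by have := sj x xs; rewrite (negPf (nv x xs)).
have vy := next_cycle cs vs; have ys : next s v \in s by rewrite mem_next.
have yv : next s v != v by apply: contraTneq vy => ->; rewrite irr.
have := sA _ ys; rewrite !inE (negPf yv) /= => /noarc /(_ vy).
have := sj _ vs; have := sj _ ys; rewrite (negPf yv) eqxx => /eqP -> /eqP ->.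
by rewrite eqxx.
Qed.

Lemma acyclic_on_fresh e B v k f :
    irreflexive e -> acyclic_on e B k f ->
  exists f', acyclic_on e (v |: B) k.+1 f'.
Proof.
move=> irr fB; exists (fun x => if x == v then k else f x).
apply: (acyclic_on_extend irr fB _ _ _) => // y yB _.
by have := proj1 fB y yB; case: ltngtP.
Qed.

(** With more classes than out-neighbors, one class receives no arc. *)
Lemma acyclic_on_reuse e B v k f :
    irreflexive e -> acyclic_on e B k f -> #|[set y in B | e v y]| < k ->
  exists f', acyclic_on e (v |: B) k f'.
Proof.
move=> irr fB; set N := [set y in B | e v y] => ltNk.
have /allPn[i] : ~~ all [in map f (enum N)] (iota 0 k).
  apply: contraL ltNk => /allP sub; rewrite -leqNgt.
  by have := uniq_leq_size (iota_uniq 0 k) sub; rewrite size_iota size_map -cardE.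
rewrite mem_iota /= add0n => ik iN; exists (fun x => if x == v then i else f x).
apply: (acyclic_on_extend irr fB _ ik _) => // y yB vy.
by apply: contraNneq iN => <-; rewrite map_f // mem_enum inE yB.
Qed.

End PartialColorings.

Lemma dc_leq_acyclic_on (G : digraph) k f :
  acyclic_on (@arc G) [set: G] k f -> dc G <= k.
Proof.
move=> [fk fP]; have {}fk x : f x < k by apply: fk; rewrite inE.
apply: leq_trans (_ : #|(fun x => Ordinal (fk x)) @: [set: G]| <= k).
  apply: dc_leq_imset => t s s0 cs; apply: contra (fP t s s0 cs _) => // x _.
  by rewrite inE.
by rewrite -[X in _ <= X]card_ord max_card.
Qed.

(** * The sums *)

Section Sums.
Variable D : digraph.
Let n := #|D|.

(** Induction on [A], removing a vertex [v].  If [v] has fewer out-neighbors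
    than there are colors in [D] or in the complement, it reuses a color there
    and takes a fresh one on the other side.  Otherwise the out-degrees of [v],
    which add up to [#|A| - 1], bound [k + l], which leaves room for two fresh
    colors. *)
Lemma exists_acyclic_on_pair (A : {set D}) :
  exists k l, [/\ k + l <= #|A|.+1,
    exists f, acyclic_on (@arc D) A k f &
    exists g, acyclic_on (@compl_arc D) A l g].
Proof.
move: {2}#|A| (erefl #|A|) => m; elim: m A => [|m IH] A Am.
  have A0 : A = set0 by apply/eqP; rewrite -cards_eq0 Am.
  exists 0, 0; rewrite A0; split=> //; exists (fun=> 0); split=> [x|i [//|x s] _ _ sub].
  - by rewrite inE.
  - by have := sub x (mem_head x s); rewrite inE.
  - by rewrite inE.
  - by have := sub x (mem_head x s); rewrite inE.
have /set0Pn[v vA] : A != set0 by rewrite -cards_eq0 Am.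
pose B := A :\ v; have vB : v \notin B by rewrite !inE eqxx.
have Bm : #|B| = m by have := cardsD1 v A; rewrite vA Am => -[].
have EA : A = v |: B by rewrite setD1K.
have [k [l [kl [f fB] [g gB]]]] := IH B Bm.
have irr := @arc_irr D; have irrc := @compl_arc_irr D.
have degs : #|[set y in B | arc v y]| + #|[set y in B | compl_arc v y]| = #|B|.
  rewrite -(cardsID [set y | arc v y] B); congr (_ + _); apply: eq_card => y.
    by rewrite !inE andbC.
  rewrite !inE /compl_arc /= (eq_sym v y).
  by case: (y == v); case: (arc v y); case: (y \in A).
have fresh := acyclic_on_fresh v irr fB.
have freshc := acyclic_on_fresh v irrc gB.
rewrite EA cardsU1 vB add1n.
have [dk|kd] := ltnP #|[set y in B | arc v y]| k.
  by exists k, l.+1; split; rewrite ?addnS //; apply: acyclic_on_reuse irr fB dk.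
have [dl|ld] := ltnP #|[set y in B | compl_arc v y]| l.
  by exists k.+1, l; split; rewrite ?addSn //; apply: acyclic_on_reuse irrc gB dl.
by exists k.+1, l.+1; split=> //; rewrite addSn addnS !ltnS -degs leq_add.
Qed.

Lemma dc_add_complement : dc D + dc (complement D) <= n.+1.
Proof.
have [k [l [kl [f fD] [g gD]]]] := exists_acyclic_on_pair [set: D].
rewrite cardsT in kl; apply: leq_trans kl; apply: leq_add.
  exact: dc_leq_acyclic_on fD.
exact: (@dc_leq_acyclic_on (complement D)) gD.
Qed.

(** Let [S] be the set of vertices alone in their class in an optimal complete
    acyclic coloring of [D].  Counting vertices by class gives
    [2 * dac D <= n + #|S|], while completeness makes [S] independent in the
    complement. *)
Lemma dac_add_complement : 2 * (dac D + dc (complement D)) <= 3 * n + 1.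
Proof.
have : complete_acyclic_colorable D (dac D) by rewrite /dac; case: ex_maxnP.
move: (dac D) => k /existsP[c /and3P[/forallP surj _ compl]].
pose S := [set x | [forall y, (c y == c x) ==> (y == x)]].
have SP x y : x \in S -> c y = c x -> y = x.
  by rewrite inE => /forallP/(_ y) /implyP xS cyx; apply/eqP/xS/eqP.
have indep : {in S &, forall x y, ~~ @arc (complement D) x y}.
  move=> x y xS yS /=; rewrite negb_and !negbK; case: eqVneq => //= xy.
  have cxy : c x != c y by apply: contra_neq xy => /(SP _ _ yS).
  have /existsP[u /existsP[w /and3P[uw /eqP cu /eqP cw]]] :=
    implyP (forallP (forallP compl (c x)) (c y)) cxy.
  by rewrite -(SP _ _ xS cu) -(SP _ _ yS cw).
have dcS : dc (complement D) <= (#|~: S|).+1 :=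
  @dc_leq_independent (complement D) S indep.
have dcn : dc (complement D) <= n := dc_leq_order (complement D).
have cardS : #|S| + #|~: S| = n by rewrite cardsC.
(* Independence gives dc <= n - #|S| + 1, which exceeds the target when S is
   empty; there dc <= n is needed instead. *)
suff kS : 2 * k <= n + #|S| by lia.
have cS : #|S| = #|c @: S|.
  by rewrite card_in_imset // => x y _ yS /(SP _ _ yS).
(* Each class counts its vertices, plus one if it is a singleton. *)
have -> : n = \sum_i #|[set x | c x == i]|.
  rewrite /n -sum1_card (partition_big c predT) //=.
  by apply: eq_bigr => i _; rewrite -sum1_card; apply: eq_bigl => x; rewrite inE.
rewrite cS -sum1_card [X in _ <= _ + X]big_mkcond /= -big_split /=.
rewrite mulnC -[X in X * 2]card_ord -sum_nat_const leq_sum // => i _.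
have /existsP[x /eqP cx] := surj i.
have [iS|iS] := boolP (i \in c @: S).
  by rewrite addn1 ltnS card_gt0; apply/set0Pn; exists x; rewrite inE cx.
have : x \notin S by apply: contra iS => xS; rewrite -cx imset_f.
rewrite inE negb_forall => /existsP[y]; rewrite negb_imply => /andP[/eqP cy yx].
have sub : [set x; y] \subset [set x | c x == i].
  by apply/subsetP => z /set2P[]->; rewrite inE ?cy cx.
by rewrite addn0; apply: leq_trans (subset_leq_card sub); rewrite cards2 eq_sym yx.
Qed.

End Sums.

(** * From natural numbers to ceilings and squares *)

Import Order.TTheory GRing.Theory Num.Theory.
Local Open Scope ring_scope.

(** Since [m] is an integer, [m <= ceil (p / q)] as soon as
    [m - 1 < p / q]. *)
Lemma le_ceil_ratio (m p q : nat) :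
  (0 < q)%N -> (q * m < p + q)%N -> m%:Z <= Num.ceil (p%:R / q%:R : rat).
Proof.
move=> q0 mpq; have [m0|m0] := posnP m.
  by rewrite m0 ceil_ge0 // (lt_le_trans (ltrN10 _)) // divr_ge0.
rewrite leNgt; apply/negP.
rewrite -[m]prednK // -addn1 PoszD ltzD1 ceil_le_int.
rewrite ler_pdivrMr ?ltr0n // -pmulrn -natrM ler_nat => h.
by move: h mpq; rewrite -{2}[m]prednK // mulnS mulnC; lia.
Qed.

Lemma mulr_le_sqr_mean (R : realFieldType) (a b t : R) :
  0 <= a + b -> a + b <= 2 * t -> a * b <= t ^+ 2.
Proof. by move=> ab0 abt; have := sqr_ge0 (a - b); nra. Qed.

Theorem theorem26 (D : digraph) (n : nat) (hn : #|D| = n) :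
  ((dc D + dc (complement D))%:Z <= Num.ceil ((4 * n)%:R / 3 : rat)
   /\ (dc D * dc (complement D))%:R <= ((2 * n + 1)%:R / 3 : rat) ^+ 2)
  /\
  ((dac D + dc (complement D))%:Z <= Num.ceil ((3 * n)%:R / 2 : rat)
   /\ (dac D * dc (complement D))%:R <= ((3 * n + 1)%:R / 4 : rat) ^+ 2).
Proof.
have dc_sum : (3 * (dc D + dc (complement D)) <= 4 * n + 2)%N.
  have := dc_add_complement D; have := dc_leq_order D.
  have : (dc (complement D) <= #|D|)%N := dc_leq_order (complement D).
  rewrite hn; lia.
have dac_sum : (2 * (dac D + dc (complement D)) <= 3 * n + 1)%N.
  by rewrite -hn; exact: dac_add_complement.
have mean a b p q : (0 < q)%N -> (q * (a + b) <= 2 * p)%N ->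
    (a * b)%:R <= (p%:R / q%:R : rat) ^+ 2.
  move=> q0 abp; rewrite natrM; apply: mulr_le_sqr_mean; rewrite -natrD //.
  by rewrite mulrA ler_pdivlMr ?ltr0n // mulrC -!natrM ler_nat.
split; split.
- by apply: le_ceil_ratio; lia.
- by apply: mean; lia.
- by apply: le_ceil_ratio; lia.
- by apply: mean; lia.
Qed.
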